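(* Let $\mathscr{M}$ be an $n$-dimensional smooth manifold and let $X(\cdot,t):\mathscr{M}\to\mathbb{R}^{n+1}$ be a smooth one-parameter family of hypersurface immersions solving the hyperbolic mean curvature flow $\frac{\partial^2X}{\partial t^2}=H\vec n$. Then, in any local coordinates $\{x^i\}$ on $\mathscr{M}$, $$\frac{\partial^2 g_{ij}}{\partial t^2}=-2Hh_{ij}+2\Big(\frac{\partial^2X}{\partial t\partial x^i},\frac{\partial^2X}{\partial t\partial x^j}\Big),$$ $$\frac{\partial^2\vec n}{\partial t^2}=-g^{ij}\frac{\partial H}{\partial x^i}\frac{\partial X}{\partial x^j}+g^{ij}\Big(\vec n,\frac{\partial^2X}{\partial t\partial x^i}\Big)\Big[2g^{kl}\Big(\frac{\partial X}{\partial x^j},\frac{\partial^2X}{\partial t\partial x^l}\Big)\frac{\partial X}{\partial x^k}+g^{kl}\Big(\frac{\partial X}{\partial x^l},\frac{\partial^2X}{\partial t\partial x^j}\Big)\frac{\partial X}{\partial x^k}-\frac{\partial^2X}{\partial t\partial x^j}\Big],$$ and $$\frac{\partial^2h_{ij}}{\partial t^2}=\bigtriangleup h_{ij}-2Hh_{il}h_{mj}g^{lm}+|A|^2h_{ij}+g^{kl}h_{ij}\Big(\vec n,\frac{\partial^2X}{\partial t\partial x^k}\Big)\Big(\vec n,\frac{\partial^2X}{\partial t\partial x^l}\Big)-2\frac{\partial\Gamma^k_{ij}}{\partial t}\Big(\vec n,\frac{\partial^2X}{\partial t\partial x^k}\Big).$$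
   Context: Repeated indices are summed from $1$ to $n$, and $(\cdot,\cdot)$ is the Euclidean inner product on $\mathbb{R}^{n+1}$. For each $t$: - $\vec n(x,t)$ is the unit inner normal vector of $X(\cdot,t)$. - $g_{ij}=\big(\frac{\partial X}{\partial x^i},\frac{\partial X}{\partial x^j}\big)$ is the induced metric, $g^{ij}$ its inverse, and $\Gamma^k_{ij}$ its Christoffel symbols. - $A=\{h_{ij}\}$ is the second fundamental form, with sign fixed by the Gauss–Weingarten relations $\frac{\partial^2X}{\partial x^i\partial x^j}=\Gamma^k_{ij}\frac{\partial X}{\partial x^k}+h_{ij}\vec n$ and $\frac{\partial\vec n}{\partial x^j}=-h_{jl}g^{lm}\frac{\partial X}{\partial x^m}$. - $H=g^{ij}h_{ij}$ is the mean curvature, and $|A|^2=g^{ij}g^{kl}h_{ik}h_{jl}$. - $\nabla$ is the Levi-Civita connection of $g(t)$, and $\bigtriangleup h_{ij}=g^{kl}\nabla_k\nabla_lh_{ij}$ is the rough Laplacian of the tensor $h$. *)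

(* Defs.v *)
From mathcomp Require Import all_boot all_order all_algebra.
From mathcomp Require Import all_classical all_reals all_analysis.

Set Implicit Arguments.
Unset Strict Implicit.
Unset Printing Implicit Defensive.

Import Order.TTheory GRing.Theory Num.Theory.
Import numFieldNormedType.Exports.

Local Open Scope classical_set_scope.
Local Open Scope ring_scope.

(* C^oo regularity on an open set D: every iterated directional derivative
   D_(v1) ... D_(vk) f, with k = 0 included, is differentiable at every point
   of D.  For finite-dimensional V this is the usual notion. *)
Definition smooth_on (R : realType) (V W : normedModType R)
    (D : set V) (f : V -> W) : Prop :=
  forall (vs : seq V) (p : V), D p ->
    differentiable (foldr (fun v g => 'D_v g) f vs) p.

(* The two total functions are only meaningful on chart_dom and chart_cod. *)
Record chart (R : realType) (M : topologicalType) (n : nat) := Chart {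
  chart_dom : set M;
  chart_cod : set 'rV[R]_n;
  chart_map : M -> 'rV[R]_n;
  chart_inv : 'rV[R]_n -> M;
  chart_dom_open : open chart_dom;
  chart_cod_open : open chart_cod;
  chart_map_cod : forall m, chart_dom m -> chart_cod (chart_map m);
  chart_inv_dom : forall x, chart_cod x -> chart_dom (chart_inv x);
  chart_mapK : forall m, chart_dom m -> chart_inv (chart_map m) = m;
  chart_invK : forall x, chart_cod x -> chart_map (chart_inv x) = x;
  chart_map_cont : {within chart_dom, continuous chart_map};
  chart_inv_cont : {within chart_cod, continuous chart_inv}
}.

Definition smooth_transition (R : realType) (M : topologicalType) (n : nat)
    (c1 c2 : chart R M n) : Prop :=
  smooth_on [set x | chart_cod c1 x /\ chart_dom c2 (chart_inv c1 x)]
    (fun x => chart_map c2 (chart_inv c1 x)).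

Definition compatible_charts (R : realType) (M : topologicalType) (n : nat)
    (c1 c2 : chart R M n) : Prop :=
  smooth_transition c1 c2 /\ smooth_transition c2 c1.

(* The smooth structure is a maximal atlas, so its members are exactly the
   local coordinate systems of the manifold. *)
Record smoothManifold (R : realType) (n : nat) := SmoothManifold {
  carrier :> topologicalType;
  atlas : set (chart R carrier n);
  manifold_hausdorff : hausdorff_space carrier;
  manifold_second_countable : @second_countable carrier;
  atlas_cover : forall m : carrier, exists2 c, atlas c & chart_dom c m;
  atlas_compatible :
    forall c1 c2, atlas c1 -> atlas c2 -> compatible_charts c1 c2;
  atlas_maximal :
    forall c, (forall c', atlas c' -> compatible_charts c c') -> atlas c
}.

Definition inner_prod (R : realType) (m : nat) (u v : 'rV[R]_m) : R :=
  \sum_(a < m) u 0 a * v 0 a.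

Section SpaceTime.
Context {R : realType} {n : nat}.

(* Points of space-time are pairs (x, t). *)
Local Notation ST := ('rV[R]_n * R^o)%type.

Definition dx {W : normedModType R} (i : 'I_n) (f : ST -> W) : ST -> W :=
  'D_((delta_mx 0 i, 0) : ST) f.

Definition dt {W : normedModType R} (f : ST -> W) : ST -> W :=
  'D_((0, 1) : ST) f.

(* X is the position vector and N the unit normal, both in local coordinates. *)
Implicit Types (X N : ST -> 'rV[R]_n.+1) (p : ST) (i j k l m : 'I_n).

Definition metric X i j : ST -> R^o :=
  fun p => inner_prod (dx i X p) (dx j X p).

Definition inv_metric X i j : ST -> R^o :=
  fun p => invmx (\matrix_(k, l) metric X k l p) i j.

(* christoffel X k i j is Gamma^k_(i j). *)
Definition christoffel X k i j : ST -> R^o := fun p =>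
  2^-1 * \sum_l inv_metric X k l p *
    (dx i (metric X j l) p + dx j (metric X i l) p - dx l (metric X i j) p).

(* Normal component of d^2 X / dx^i dx^j, as in the Gauss formula
   d_i d_j X = Gamma^k_(i j) d_k X + h_(i j) N. *)
Definition second_form X N i j : ST -> R^o :=
  fun p => inner_prod (dx i (dx j X) p) (N p).

Definition mean_curv X N : ST -> R^o :=
  fun p => \sum_i \sum_j inv_metric X i j p * second_form X N i j p.

Definition normA2 X N : ST -> R^o := fun p =>
  \sum_i \sum_j \sum_k \sum_l inv_metric X i j p * inv_metric X k l p *
    second_form X N i k p * second_form X N j l p.

(* cov_deriv2 X T l i j is nabla_l T_(i j), and cov_deriv3 X S k l i j is
   nabla_k S_(l i j), for covariant tensors given by their components. *)
Definition cov_deriv2 X (T : 'I_n -> 'I_n -> ST -> R^o) l i j : ST -> R^o :=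
  fun p => dx l (T i j) p
    - \sum_m christoffel X m l i p * T m j p
    - \sum_m christoffel X m l j p * T i m p.

Definition cov_deriv3 X (S : 'I_n -> 'I_n -> 'I_n -> ST -> R^o) k l i j :
    ST -> R^o :=
  fun p => dx k (S l i j) p
    - \sum_m christoffel X m k l p * S m i j p
    - \sum_m christoffel X m k i p * S l m j p
    - \sum_m christoffel X m k j p * S l i m p.

Definition rough_laplacian X (T : 'I_n -> 'I_n -> ST -> R^o) i j :
    ST -> R^o :=
  fun p => \sum_k \sum_l
    inv_metric X k l p * cov_deriv3 X (cov_deriv2 X T) k l i j p.

End SpaceTime.

Section Flow.
Context {R : realType} {n : nat} (M : smoothManifold R n).
Implicit Types (I : set R) (X N : M -> R -> 'rV[R]_n.+1).

Definition in_chart (c : chart R M n) (F : M -> R -> 'rV[R]_n.+1) :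
    'rV[R]_n * R^o -> 'rV[R]_n.+1 :=
  fun p => F (chart_inv c p.1) p.2.

Definition chart_times (c : chart R M n) I : set ('rV[R]_n * R^o) :=
  [set p | chart_cod c p.1 /\ I p.2].

Definition smooth_family I X : Prop :=
  forall c, atlas c -> smooth_on (chart_times c I) (in_chart c X).

Definition immersions I X : Prop :=
  forall c, atlas c -> forall p, chart_times c I p ->
    row_free (\matrix_(i < n) dx i (in_chart c X) p).

(* A choice of unit normal at every point.  No regularity is imposed here, so
   such an N exists even if M is not orientable. *)
Definition unit_normal I X N : Prop :=
  forall c, atlas c -> forall p, chart_times c I p ->
    inner_prod (in_chart c N p) (in_chart c N p) = 1 /\
    forall i, inner_prod (in_chart c N p) (dx i (in_chart c X) p) = 0.

(* The right-hand side H N is unchanged when N is replaced by - N. *)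
Definition hyperbolic_mcf I X N : Prop :=
  forall c, atlas c -> forall p, chart_times c I p ->
    dt (dt (in_chart c X)) p
      = mean_curv (in_chart c X) (in_chart c N) p *: in_chart c N p.

End Flow.

(* Main.v *)
From HB Require Import structures.
Require Import Defs.
From mathcomp Require Import all_boot all_order all_algebra.
From mathcomp Require Import all_classical all_reals all_analysis.
From mathcomp Require Import ring.
Import Order.TTheory GRing.Theory Num.Theory.
Import numFieldNormedType.Exports.

Set Implicit Arguments.
Unset Strict Implicit.
Unset Printing Implicit Defensive.

Local Open Scope classical_set_scope.
Local Open Scope ring_scope.

(** The three formulas are identities of differential algebra: they use only
    that the partial derivatives are commuting derivations of a commutative ring
    containing the coordinates of the immersion and of the normal, together with
    the inverse of the metric. So they are proved for vectors over an abstract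
    commutative ring with derivations, where equations hold outright and can be
    differentiated by rewriting, and then specialised to the ring of smooth
    functions on the domain of the chart.

    In the ring, write J for the matrix whose rows are the tangent vectors
    d_i X, and E for the dual frame g^-1 J. Every vector decomposes along the
    tangent vectors and the unit normal nu ([frame_resolution]). Applied to the
    derivatives of J, nu and E this gives the Gauss-Weingarten relations and
    that g^-1 is parallel; commuting two derivations gives the Codazzi and Gauss
    equations ([codazzi], [gauss_curvature]). From these and the Ricci identity
    one gets Simons' identity ([simons])

      Delta h_ij = nabla_i nabla_j H + H h_il g^lm h_mj - |A|^2 h_ij.

    For the metric one differentiates (d_i X, d_j X) twice in time and inserts
    the flow equation; the normal component of d_j X being zero, the derivative
    of H does not contribute ([metric_evolution]). For the normal one compares
    inner products of both sides with the frame ([normal_evolution]). For h_ij =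
    (d_i d_j X, nu), the flow equation produces the Hessian of H, which Simons'
    identity replaces by Delta h; the terms in |d_t nu|^2 combine to a single
    one because the Gauss decomposition of d_i d_j X contributes twice with a
    plus sign and once with a minus sign ([second_form_evolution]).

    That smooth functions form such a ring needs their stability under products
    and inverses ([smooth_exprP]) and the symmetry of second derivatives
    ([schwarz]), obtained from the mean value theorem. The immersion condition
    makes the determinant of the metric invertible in the ring ([gram_unit],
    [smfun_gram_inv]); evaluation at a point is a ring morphism, and carries the
    identities back to the real-valued quantities of the statement. *)

(** * Derivations acting on matrices *)

Definition leibniz (A : comNzRingType) (d : A -> A) : Prop :=
  forall x y, d (x * y) = d x * y + x * d y.

Lemma mx_addE (V : zmodType) m n (P Q : 'M[V]_(m, n)) i j :
  (P + Q) i j = P i j + Q i j.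
Proof. by rewrite mxE. Qed.

Lemma mx_oppE (V : zmodType) m n (P : 'M[V]_(m, n)) i j : (- P) i j = - P i j.
Proof. by rewrite mxE. Qed.

Lemma mx_trB (V : zmodType) m n (P Q : 'M[V]_(m, n)) :
  (P - Q)^T = P^T - Q^T.
Proof. exact: raddfB. Qed.

(** Proves linear relations between matrix products: each product becomes an
    opaque matrix, after which the entries are elements of a commutative ring. *)
Ltac mx_abel :=
  repeat match goal with |- context [@mulmx ?S ?m ?n ?p ?P ?Q] =>
    move: (@mulmx S m n p P Q) => ? end;
  apply/matrixP => ? ?; rewrite !(mx_addE, mx_oppE); ring.

Section MatrixDerivation.
Context {A : comNzRingType} (d : {additive A -> A}) (dM : leibniz d).

Lemma derivation1 : d 1 = 0.
Proof.
have := dM 1 1; rewrite !mulr1 mul1r => /eqP.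
by rewrite -subr_eq subrr => /eqP.
Qed.

Lemma map_mx_leibniz m n p (P : 'M[A]_(m, n)) (Q : 'M[A]_(n, p)) :
  map_mx d (P *m Q) = map_mx d P *m Q + P *m map_mx d Q.
Proof.
apply/matrixP=> i j; rewrite !mxE raddf_sum -big_split /=.
by apply: eq_bigr => k _; rewrite dM !mxE.
Qed.

Lemma map_mx_leibniz1 n : map_mx d 1%:M = 0 :> 'M[A]_n.
Proof.
by apply/matrixP=> i j; rewrite !mxE; case: eqP => _; rewrite ?raddf0 ?derivation1.
Qed.

Lemma map_mx_leibnizZ m n x (P : 'M[A]_(m, n)) :
  map_mx d (x *: P) = d x *: P + x *: map_mx d P.
Proof. by apply/matrixP=> i j; rewrite !mxE dM. Qed.

Lemma leibniz_mxtrace n (P : 'M[A]_n) : d (\tr P) = \tr (map_mx d P).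
Proof. by rewrite /mxtrace raddf_sum; apply: eq_bigr => i _; rewrite !mxE. Qed.

End MatrixDerivation.

(** * Moving frames over a ring with derivations *)

(** The rows of [J] stand for a tangent frame, those of [E] for its dual frame
    inside the tangent space, and [nu] for the unit normal. Then [E *m E^T] is
    the inverse of the Gram matrix [J *m J^T]. *)
Section MovingFrame.
Context {A : comNzRingType} {n : nat}.
Variables (J E : 'M[A]_(n, n.+1)) (nu : 'rV[A]_n.+1).
Hypothesis nu_unit : nu *m nu^T = 1%:M.
Hypothesis frame_perp : J *m nu^T = 0.
Hypothesis dual_perp : E *m nu^T = 0.
Hypothesis dual_frame : E *m J^T = 1%:M.
Hypothesis two_reg : forall x : A, x + x = 0 -> x = 0.

Local Notation gi := (E *m E^T).

Lemma perp_dual : nu *m E^T = 0.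
Proof. by rewrite -(trmxK nu) -trmx_mul dual_perp trmx0. Qed.

Lemma perp_frame : nu *m J^T = 0.
Proof. by rewrite -(trmxK nu) -trmx_mul frame_perp trmx0. Qed.

(** Stacking [nu] on [E] and [nu] on [J] gives two square matrices, the first
    of which is a left inverse of the transpose of the second. Over a
    commutative ring it is then also a right inverse, which is this identity. *)
Lemma frame_resolution : J^T *m E + nu^T *m nu = 1%:M.
Proof.
have FK : (col_mx nu E : 'M[A]_(1 + n, n.+1)) *m row_mx nu^T J^T
          = 1%:M :> 'M[A]_(1 + n).
  rewrite mul_col_row nu_unit dual_frame dual_perp perp_frame.
  by rewrite -scalar_mx_block.
by have := mulmx1C FK; rewrite mul_row_col addrC.
Qed.

Lemma frame_decomp m (V : 'M[A]_(m, n.+1)) :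
  V = (V *m E^T) *m J + (V *m nu^T) *m nu.
Proof.
have: (J^T *m E + nu^T *m nu)^T = 1%:M by rewrite frame_resolution trmx1.
rewrite raddfD /= !trmx_mul !trmxK => e.
by rewrite -!mulmxA -mulmxDr e mulmx1.
Qed.

Lemma dual_frame_decomp m (V : 'M[A]_(m, n.+1)) :
  V = (V *m J^T) *m E + (V *m nu^T) *m nu.
Proof. by rewrite -!mulmxA -mulmxDr frame_resolution mulmx1. Qed.

(** For the derivation along [x^i], row [l] and column [m] hold [Gamma^m_(i l)],
    the tangential components of the derivative of the frame. *)
Definition connection (d : A -> A) : 'M[A]_n := map_mx d J *m E^T.
(** The normal components of the derivative of the frame: for the derivation
    along [x^i], column [i] of the second fundamental form. *)
Definition shape_col (d : A -> A) : 'cV_n := map_mx d J *m nu^T.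

Lemma frame_derive (d : A -> A) : map_mx d J = connection d *m J + shape_col d *m nu.
Proof. exact: frame_decomp. Qed.

Section OneDerivation.
Context (d : {additive A -> A}) (dM : leibniz d).

(** Differentiating [(nu, nu) = 1] gives twice this product. *)
Lemma normal_derive_perp : map_mx d nu *m nu^T = 0.
Proof.
have /(congr1 (fun P : 'M[A]_1 => P 0 0)) := map_mx_leibniz dM nu nu^T.
rewrite nu_unit map_mx_leibniz1 // -map_trmx.
have -> : nu *m (map_mx d nu)^T = map_mx d nu *m nu^T.
  apply/matrixP=> i j; rewrite !ord1 !mxE.
  by apply: eq_bigr => k _; rewrite !mxE mulrC.
rewrite [LHS]mxE [RHS]mxE => /esym/two_reg e.
by apply/matrixP=> i j; rewrite !ord1 e mxE.
Qed.

(** The tangential components of the derivative of [nu] are read off by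
    differentiating the orthogonality of [nu] and [J]. *)
Lemma weingarten : map_mx d nu = - ((shape_col d)^T *m E).
Proof.
rewrite [LHS]dual_frame_decomp normal_derive_perp mul0mx addr0 -mulNmx.
congr (_ *m _); apply/eqP; rewrite -addr_eq0.
rewrite /shape_col trmx_mul trmxK map_trmx -map_mx_leibniz //.
by rewrite perp_frame map_mx0.
Qed.

(** The components of the derivative of [E] are found by differentiating
    [E *m J^T = 1] and [E *m nu^T = 0]. *)
Lemma dual_frame_derive :
  map_mx d E = - ((connection d)^T *m E) + gi *m shape_col d *m nu.
Proof.
rewrite [LHS]dual_frame_decomp; congr (_ + _); last congr (_ *m _).
  rewrite -mulNmx; congr (_ *m _); apply/eqP; rewrite -addr_eq0.
  rewrite /connection trmx_mul trmxK map_trmx -map_mx_leibniz //.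
  by rewrite dual_frame map_mx_leibniz1.
have := map_mx_leibniz dM E nu^T.
rewrite dual_perp map_mx0 -map_trmx weingarten raddfN /= trmx_mul trmxK.
by rewrite mulmxN mulmxA => /eqP; rewrite eq_sym subr_eq0 => /eqP.
Qed.

(** The inverse metric is parallel: the normal part of the derivative of [E]
    is orthogonal to [E] and drops out. *)
Lemma gram_inv_derive :
  map_mx d gi = - ((connection d)^T *m gi) - gi *m connection d.
Proof.
rewrite map_mx_leibniz // -map_trmx dual_frame_derive.
rewrite mulmxDl raddfD /= mulmxDr raddfN /= !trmx_mul !trmxK mulNmx mulmxN.
rewrite -!mulmxA perp_dual !mulmx0 addr0.
by rewrite [E *m (nu^T *m _)]mulmxA dual_perp mul0mx addr0.
Qed.

Definition cov_deriv (P : 'M[A]_n) : 'M[A]_n :=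
  map_mx d P - connection d *m P - P *m (connection d)^T.

(** As the inverse metric is parallel, contracting with it commutes with
    covariant differentiation. *)
Lemma derive_trace (P : 'M[A]_n) : d (\tr (gi *m P)) = \tr (gi *m cov_deriv P).
Proof.
rewrite leibniz_mxtrace map_mx_leibniz // gram_inv_derive /cov_deriv.
move: (connection d) => G; move: gi (map_mx d P) => g dP.
have -> : \tr (g *m (dP - G *m P - P *m G^T))
    = \tr (g *m dP) - \tr (g *m G *m P) - \tr (G^T *m g *m P).
  rewrite !mulmxBr !raddfB /= !mulmxA; congr (_ - _).
  by rewrite mxtrace_mulC mulmxA.
rewrite mulmxBl mulNmx mxtraceD raddfB /= raddfN /=.
ring.
Qed.

End OneDerivation.

(** Differentiating the components of [map_mx b J] along [a] yields a term that
    is symmetric in two commuting derivations [a] and [b], plus quadratic terms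
    in [connection] and [shape_col]. Antisymmetrising leaves only the latter:
    the Gauss equation comes from the tangential components, the Codazzi
    equation from the normal ones. *)
Section TwoDerivations.
Context (a b : {additive A -> A}) (aM : leibniz a) (bM : leibniz b).
Hypothesis ab : forall x, a (b x) = b (a x).

Lemma map_mx_comm p q (P : 'M[A]_(p, q)) :
  map_mx a (map_mx b P) = map_mx b (map_mx a P).
Proof. by apply/matrixP=> i j; rewrite !mxE ab. Qed.

Lemma connection_derive :
  map_mx a (connection b)
  = map_mx a (map_mx b J) *m E^T - connection b *m connection a
    + shape_col b *m ((shape_col a)^T *m gi).
Proof.
rewrite map_mx_leibniz // -map_trmx dual_frame_derive // raddfD raddfN /=.
rewrite !trmx_mul !trmxK mulmxDr mulmxN !mulmxA addrA.
by rewrite -/(connection b) -/(shape_col b).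
Qed.

Lemma shape_derive :
  map_mx a (shape_col b)
  = map_mx a (map_mx b J) *m nu^T - connection b *m shape_col a.
Proof.
rewrite map_mx_leibniz // -map_trmx weingarten // raddfN /= trmx_mul trmxK.
by rewrite mulmxN mulmxA.
Qed.

End TwoDerivations.

Section Curvature.
Context (a b : {additive A -> A}) (aM : leibniz a) (bM : leibniz b).
Hypothesis ab : forall x, a (b x) = b (a x).

Lemma codazzi :
  map_mx a (shape_col b) - connection a *m shape_col b
  = map_mx b (shape_col a) - connection b *m shape_col a.
Proof.
rewrite !shape_derive // map_mx_comm //.
by rewrite addrAC.
Qed.

Definition curvature : 'M[A]_n :=
  map_mx a (connection b) - map_mx b (connection a)
  - (connection a *m connection b - connection b *m connection a).

Lemma gauss_curvature :
  curvature = (shape_col b *m (shape_col a)^T - shape_col a *m (shape_col b)^T) *m gi.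
Proof.
rewrite /curvature !connection_derive // map_mx_comm //.
move: (connection a) (connection b) (shape_col a) (shape_col b) => Ga Gb ea eb.
rewrite mulmxBl -!mulmxA.
mx_abel.
Qed.

Lemma ricci_identity (P : 'M[A]_n) :
  cov_deriv a (cov_deriv b P) - cov_deriv b (cov_deriv a P)
  = - (curvature *m P) - P *m curvature^T.
Proof.
rewrite /cov_deriv /curvature.
move: (connection a) (connection b) => Ga Gb.
rewrite !(map_mxB, map_mx_leibniz) // -!map_trmx map_mx_comm //.
rewrite !mx_trB !trmx_mul !mulmxBl ?mulmxBr ?mulmxDl ?mulmxDr.
rewrite ?mulmxBl ?mulmxBr -!mulmxA.
mx_abel.
Qed.

End Curvature.
End MovingFrame.

(** * Geometry of a hypersurface over a differential ring *)

Definition dotv (A : pzRingType) m (u v : 'rV[A]_m) : A := \sum_a u 0 a * v 0 a.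

Section DotTheory.
Context {A : comNzRingType} {m : nat}.
Implicit Types u v w : 'rV[A]_m.

Lemma dotvE u v : dotv u v = (u *m v^T) 0 0.
Proof. by rewrite mxE; apply: eq_bigr => a _; rewrite mxE. Qed.

Lemma mulmx_dotv u v : u *m v^T = (dotv u v)%:M.
Proof. by rewrite dotvE -mx11_scalar. Qed.

Lemma dotvC u v : dotv u v = dotv v u.
Proof. by apply: eq_bigr => a _; rewrite mulrC. Qed.

Lemma dotvDl u v w : dotv (u + v) w = dotv u w + dotv v w.
Proof. by rewrite !dotvE mulmxDl mxE. Qed.

Lemma dotvNl u w : dotv (- u) w = - dotv u w.
Proof. by rewrite !dotvE mulNmx mxE. Qed.

Lemma dotvZl x u w : dotv (x *: u) w = x * dotv u w.
Proof. by rewrite !dotvE -scalemxAl mxE. Qed.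

Lemma dotv_suml (I : finType) (F : I -> 'rV[A]_m) w :
  dotv (\sum_i F i) w = \sum_i dotv (F i) w.
Proof. by rewrite dotvE mulmx_suml summxE; apply: eq_bigr => i _; rewrite dotvE. Qed.

Lemma leibniz_dotv (d : {additive A -> A}) (dM : leibniz d) u v :
  d (dotv u v) = dotv (map_mx d u) v + dotv u (map_mx d v).
Proof.
rewrite raddf_sum -big_split /=; apply: eq_bigr => a _.
by rewrite dM !mxE.
Qed.

End DotTheory.

Section Hypersurface.
Context {A : comNzRingType} {n : nat}.
Variable (dX : 'I_n -> {additive A -> A}).
Hypothesis dXM : forall i, leibniz (dX i).
Hypothesis dXC : forall i j x, dX i (dX j x) = dX j (dX i x).
Variables (Y nu : 'rV[A]_n.+1) (gi : 'M[A]_n).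

Local Notation Y_ i := (map_mx (dX i) Y).

Definition tangent_frame : 'M[A]_(n, n.+1) := \matrix_(i, a) dX i (Y 0 a).
Local Notation J := tangent_frame.
Local Notation E := (gi *m J).

Hypothesis two_reg : forall x : A, x + x = 0 -> x = 0.
Hypothesis nu_unit : dotv nu nu = 1.
Hypothesis nu_perp : forall i, dotv nu (Y_ i) = 0.
Hypothesis giK : gi *m (J *m J^T) = 1%:M.

Lemma row_tangent i : row i J = Y_ i.
Proof. by apply/rowP => a; rewrite !mxE. Qed.

Lemma gram_entry i j : (J *m J^T) i j = dotv (Y_ i) (Y_ j).
Proof. by rewrite mxE; apply: eq_bigr => a _; rewrite !mxE. Qed.

Lemma gram_invK : (J *m J^T) *m gi = 1%:M.
Proof. exact: mulmx1C giK. Qed.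

Lemma gram_inv_sym : gi^T = gi.
Proof.
have gT : (J *m J^T)^T = J *m J^T by rewrite trmx_mul trmxK.
have: gi^T *m (J *m J^T) = 1%:M by rewrite -{1}gT -trmx_mul gram_invK trmx1.
by move/(congr1 (mulmx^~ gi)); rewrite /= -mulmxA gram_invK mulmx1 mul1mx.
Qed.

Lemma gram_inv_symE i j : gi i j = gi j i.
Proof. by rewrite -[in LHS]gram_inv_sym mxE. Qed.

Lemma mx_unit : nu *m nu^T = 1%:M.
Proof. by rewrite mulmx_dotv nu_unit. Qed.

Lemma mx_perp : J *m nu^T = 0.
Proof.
apply/colP => i; rewrite [RHS]mxE -[RHS](nu_perp i) dotvC mxE.
by apply: eq_bigr => a _; rewrite !mxE.
Qed.

Lemma mx_dual_perp : E *m nu^T = 0.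
Proof. by rewrite -mulmxA mx_perp mulmx0. Qed.

Lemma mx_dual : E *m J^T = 1%:M.
Proof. by rewrite -mulmxA giK. Qed.

Lemma mx_dual_gram : E *m E^T = gi.
Proof. by rewrite trmx_mul mulmxA mx_dual mul1mx gram_inv_sym. Qed.

Local Notation conn := (connection J E).
Local Notation shp := (shape_col J nu).
Local Notation G i := (conn (dX i)).

Definition second_form_mx : 'M[A]_n := \matrix_(i, j) dotv (map_mx (dX i) (Y_ j)) nu.
Local Notation h := second_form_mx.

Lemma derive_frame_row (d : A -> A) i :
  row i (map_mx d J) = map_mx d (Y_ i).
Proof. by apply/rowP => a; rewrite !mxE. Qed.

Lemma shapeE (d : A -> A) i : shp d i 0 = dotv (map_mx d (Y_ i)) nu.
Proof.
by rewrite -derive_frame_row mxE; apply: eq_bigr => a _; rewrite !mxE.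
Qed.

Lemma h_shape i j : h i j = shp (dX i) j 0.
Proof. by rewrite shapeE mxE. Qed.

Lemma tangent_swap i j : map_mx (dX i) (Y_ j) = map_mx (dX j) (Y_ i).
Proof. exact: map_mx_comm. Qed.

Lemma h_sym i j : h i j = h j i.
Proof. by rewrite !mxE tangent_swap. Qed.

Lemma h_tr : h^T = h.
Proof. by apply/matrixP => i j; rewrite mxE h_sym. Qed.

Lemma connE (d : A -> A) i j : conn d i j = \sum_l gi j l * dotv (map_mx d (Y_ i)) (Y_ l).
Proof.
rewrite /connection trmx_mul gram_inv_sym mulmxA mxE.
apply: eq_bigr => l _; rewrite mulrC gram_inv_symE; congr (_ * _).
by rewrite -derive_frame_row mxE; apply: eq_bigr => a _; rewrite !mxE.
Qed.

(** For an induced metric, the bracket in the formula for the Christoffel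
    symbols is twice an inner product of second and first derivatives. *)
Lemma koszul i j l :
  dX i (dotv (Y_ j) (Y_ l)) + dX j (dotv (Y_ i) (Y_ l)) - dX l (dotv (Y_ i) (Y_ j))
  = 2 * dotv (map_mx (dX i) (Y_ j)) (Y_ l).
Proof.
rewrite !(leibniz_dotv (dXM _)) (tangent_swap j i) (tangent_swap l i).
rewrite (tangent_swap l j) [dotv (map_mx (dX i) (Y_ l)) _]dotvC.
ring.
Qed.

Lemma conn_sym i j m : G i j m = G j i m.
Proof. by rewrite !connE; apply: eq_bigr => l _; rewrite tangent_swap. Qed.

Definition mean_curvature : A := \tr (gi *m h).
Local Notation H := mean_curvature.

Definition nabla_h k : 'M[A]_n := cov_deriv J E (dX k) h.
Local Notation S := nabla_h.

(** The sum corrects for the index [l] of the inner derivative, so that entry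
    [(i, j)] is the component [nabla_k nabla_l h_(i j)]. *)
Definition nabla2_h k l : 'M[A]_n :=
  cov_deriv J E (dX k) (S l) - \sum_m G k l m *: S m.

Lemma cov_derivE (d : {additive A -> A}) (P : 'M[A]_n) i j :
  cov_deriv J E d P i j = d (P i j)
    - \sum_m conn d i m * P m j - \sum_m conn d j m * P i m.
Proof.
rewrite !mx_addE !mx_oppE ![in LHS]mxE; congr (_ - _ - _).
by apply: eq_bigr => m _; rewrite mxE mulrC.
Qed.

Lemma nabla_hE k i j : S k i j = dX k (h i j)
    - \sum_m G k i m * h m j - \sum_m G k j m * h i m.
Proof. exact: cov_derivE. Qed.

Lemma nabla2_hE k l i j : nabla2_h k l i j = dX k (S l i j)
  - \sum_m G k l m * S m i j
  - \sum_m G k i m * S l m j - \sum_m G k j m * S l i m.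
Proof.
rewrite mx_addE mx_oppE cov_derivE.
have -> : (\sum_m G k l m *: S m) i j = \sum_m G k l m * S m i j.
  by rewrite summxE; apply: eq_bigr => m _; rewrite mxE.
ring.
Qed.

Lemma nabla_h_sym k i j : S k i j = S k j i.
Proof.
rewrite !nabla_hE h_sym -!addrA; congr (_ + _); rewrite addrC.
by congr (- _ - _); apply: eq_bigr => m _; rewrite h_sym.
Qed.

(** With the symmetry of [h], the Codazzi equation makes the covariant
    derivative of [h] totally symmetric. *)
Lemma nabla_h_swap k i j : S k i j = S i k j.
Proof.
have := codazzi mx_unit mx_perp mx_dual_perp mx_dual two_reg (dXM k) (dXM i)
  (dXC k i).
move=> /(congr1 (fun P : 'cV_n => P j 0)) e.
rewrite !nabla_hE.
have -> : \sum_m G k i m * h m j = \sum_m G i k m * h m j.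
  by apply: eq_bigr => m _; rewrite conn_sym.
rewrite addrAC [RHS]addrAC; congr (_ - _).
move: e; rewrite !mx_addE !mx_oppE ![(map_mx _ _) _ _]mxE -!h_shape ![(_ *m _) j 0]mxE.
under eq_bigr do rewrite -h_shape.
by under [in RHS]eq_bigr do rewrite -h_shape.
Qed.

Lemma nabla2_h_sym k l i j : nabla2_h k l i j = nabla2_h k l j i.
Proof.
rewrite !nabla2_hE nabla_h_sym.
under [\sum_m G k l m * _]eq_bigr do rewrite nabla_h_sym.
rewrite -!addrA; congr (_ + (_ + _)); rewrite addrC.
by congr (- _ - _); apply: eq_bigr => m _; rewrite nabla_h_sym.
Qed.

Lemma nabla2_h_swap k l i j : nabla2_h k l i j = nabla2_h k i l j.
Proof.
rewrite !nabla2_hE nabla_h_swap.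
under [\sum_m G k l m * _]eq_bigr do rewrite nabla_h_swap.
under [\sum_m G k i m * _]eq_bigr do rewrite nabla_h_swap.
under [\sum_m G k j m * _]eq_bigr do rewrite nabla_h_swap.
ring.
Qed.

Lemma h_row_mul k (P : 'M[A]_n) i : ((shp (dX k))^T *m P) 0 i = (h *m P) k i.
Proof.
rewrite [LHS]mxE [RHS]mxE; apply: eq_bigr => m _.
by rewrite h_shape mxE.
Qed.

Local Notation B := (h *m gi *m h).

Lemma B_sym i j : B i j = B j i.
Proof.
have <- : B^T = B by rewrite !trmx_mul h_tr gram_inv_sym mulmxA.
by rewrite mxE !trmx_mul h_tr gram_inv_sym mulmxA.
Qed.

(** The Ricci identity, with the curvature expressed through [h] by the Gauss
    equation. *)
Lemma nabla2_h_commute k l i j :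
  nabla2_h k l i j - nabla2_h l k i j
  = - (h l i * B k j - h k i * B l j) - (h l j * B k i - h k j * B l i).
Proof.
have := ricci_identity J E (dXM k) (dXM l) (dXC k l) h.
rewrite (gauss_curvature mx_unit mx_perp mx_dual_perp mx_dual two_reg) //.
rewrite mx_dual_gram => e.
have {e} := congr1 (fun P : 'M[A]_n => P i j) e.
set R := (_ - _) *m gi.
have RE p q : (R *m h) p q = h l p * B k q - h k p * B l q.
  have outer (u : 'cV[A]_n) (w : 'rV[A]_n) :
      (u *m w *m gi *m h) p q = u p 0 * (w *m (gi *m h)) 0 q.
    by rewrite -!mulmxA mxE big_ord1.
  by rewrite /R !mulmxBl mx_addE mx_oppE !outer !h_row_mul -!h_shape !mulmxA.
have -> : h *m R^T = (R *m h)^T by rewrite [RHS]trmx_mul h_tr.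
rewrite !(mx_addE, mx_oppE) [(_^T) i j]mxE !RE => <-.
have -> : \sum_m G k l m *: S m = \sum_m G l k m *: S m.
  by apply: eq_bigr => m _; rewrite conn_sym.
rewrite /nabla_h; ring.
Qed.

Lemma trace_derive i (P : 'M[A]_n) :
  dX i (\tr (gi *m P)) = \tr (gi *m cov_deriv J E (dX i) P).
Proof.
have := derive_trace mx_unit mx_perp mx_dual_perp mx_dual two_reg (dXM i) P.
by rewrite mx_dual_gram.
Qed.

Lemma hessian_mean_curvature i j :
  \tr (gi *m nabla2_h i j) = dX i (dX j H) - \sum_m G i j m * dX m H.
Proof.
rewrite !trace_derive /nabla2_h mulmxBr raddfB /=; congr (_ - _).
rewrite mulmx_sumr raddf_sum /=; apply: eq_bigr => m _.
by rewrite -scalemxAr mxtraceZ trace_derive.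
Qed.

Lemma trace_gram (P : 'M[A]_n) : \tr (gi *m P) = \sum_k \sum_l gi k l * P k l.
Proof.
rewrite exchange_big; apply: eq_bigr => k _; rewrite mxE.
by apply: eq_bigr => l _; rewrite gram_inv_symE.
Qed.

(** Simons' identity. Total symmetry of [nabla_h] brings
    [nabla_k nabla_l h_(i j)] to [nabla_i nabla_j h_(k l)] at the price of a
    single commutation of covariant derivatives; contracting with the inverse
    metric turns the result into the Hessian of the mean curvature, and the
    commutator into the cubic terms in [h]. *)
Lemma simons i j :
  \sum_k \sum_l gi k l * nabla2_h k l i j
  = dX i (dX j H) - \sum_m G i j m * dX m H
    + H * B i j - \tr (gi *m B) * h i j.
Proof.
rewrite -hessian_mean_curvature !trace_gram /mean_curvature trace_gram.
have step k l : nabla2_h k l i j = nabla2_h i j k l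
    - (h i l * B k j - h k l * B i j) - (h i j * B k l - h k j * B i l).
  have := nabla2_h_commute k i l j.
  rewrite -nabla2_h_swap (nabla2_h_sym i k) (nabla2_h_swap i k j) => e.
  by rewrite -addrA -e addrC subrK.
have hgB : \sum_k \sum_l gi k l * (h i l * B k j) = (h *m gi *m B) i j.
  rewrite [RHS]mxE; apply: eq_bigr => k _; rewrite [(_ *m gi) i k]mxE mulr_suml.
  by apply: eq_bigr => l _; rewrite (gram_inv_symE k); ring.
have Bgh : \sum_k \sum_l gi k l * (h k j * B i l) = (h *m gi *m B) i j.
  rewrite !mulmxA [RHS]mxE; apply: eq_bigr => k _.
  rewrite [(_ *m gi) i k]mxE mulr_suml.
  by apply: eq_bigr => l _; rewrite (gram_inv_symE k); ring.
pose s (F : 'I_n -> 'I_n -> A) := \sum_k \sum_l gi k l * F k l.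
have sB F F' : s (fun k l => F k l - F' k l) = s F - s F'.
  rewrite /s -sumrB; apply: eq_bigr => k _; rewrite -sumrB.
  by apply: eq_bigr => l _; rewrite mulrBr.
have sM F x : s (fun k l => F k l * x) = s F * x.
  rewrite /s mulr_suml; apply: eq_bigr => k _; rewrite mulr_suml.
  by apply: eq_bigr => l _; rewrite mulrA.
transitivity (s (fun k l => nabla2_h i j k l
    - (h i l * B k j - h k l * B i j) - (B k l * h i j - h k j * B i l))).
  by apply: eq_bigr => k _; apply: eq_bigr => l _; rewrite step (mulrC (h i j)).
rewrite !sB !sM [s (fun k l => h i l * B k j)]hgB.
rewrite [s (fun k l => h k j * B i l)]Bgh /s; ring.
Qed.

Lemma trace_hgh :
  \tr (gi *m B) = \sum_i \sum_j \sum_k \sum_l gi i j * gi k l * h i k * h j l.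
Proof.
rewrite trace_gram; apply: eq_bigr => i _; apply: eq_bigr => j _.
rewrite mxE mulr_sumr exchange_big /=; apply: eq_bigr => l _.
rewrite mxE mulr_suml mulr_sumr; apply: eq_bigr => k _.
by rewrite (h_sym j); ring.
Qed.

Lemma hgh_entry i j : B i j = \sum_l \sum_m h i l * h m j * gi l m.
Proof.
rewrite mxE exchange_big; apply: eq_bigr => m _; rewrite mxE mulr_suml.
by apply: eq_bigr => l _; ring.
Qed.

(** Raising the index of [f] gives the vector whose inner products with the
    tangent frame are the components of [f]. *)
Lemma raise_frame (f : 'I_n -> A) m :
  dotv (\sum_i \sum_j (gi i j * f i) *: Y_ j) (Y_ m) = f m.
Proof.
transitivity (\sum_i f i * (1%:M : 'M[A]_n) i m).
  rewrite dotv_suml; apply: eq_bigr => i _.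
  rewrite dotv_suml -giK mxE mulr_sumr; apply: eq_bigr => j _.
  by rewrite dotvZl -gram_entry; ring.
rewrite (bigD1 m) //= mxE eqxx mulr1 big1 ?addr0 // => i /negPf im.
by rewrite mxE im mulr0.
Qed.

Lemma raise_frame_sym (f : 'I_n -> A) m :
  dotv (\sum_k \sum_l (gi k l * f l) *: Y_ k) (Y_ m) = f m.
Proof.
rewrite -[RHS](raise_frame f) exchange_big; congr (dotv _ _).
apply: eq_bigr => l _; apply: eq_bigr => k _.
by rewrite gram_inv_symE.
Qed.

Lemma raise_perp (f : 'I_n -> 'I_n -> A) (e : 'I_n -> 'I_n -> 'I_n) :
  dotv (\sum_i \sum_j f i j *: Y_ (e i j)) nu = 0.
Proof.
rewrite dotv_suml big1 // => i _; rewrite dotv_suml big1 // => j _.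
by rewrite dotvZl dotvC nu_perp mulr0.
Qed.

(** The tangent vectors and the normal span the ambient space, so a vector is
    determined by its inner products with them. *)
Lemma frame_ext (u v : 'rV[A]_n.+1) :
  (forall m, dotv u (Y_ m) = dotv v (Y_ m)) -> dotv u nu = dotv v nu -> u = v.
Proof.
move=> uvY uvn.
rewrite (dual_frame_decomp mx_unit mx_perp mx_dual_perp mx_dual u).
rewrite (dual_frame_decomp mx_unit mx_perp mx_dual_perp mx_dual v).
congr (_ + _); congr (_ *m _); last by rewrite !mulmx_dotv uvn.
have mulJ z m : (z *m J^T) 0 m = dotv z (Y_ m).
  by rewrite mxE; apply: eq_bigr => a _; rewrite !mxE.
by apply/rowP => m; rewrite !mulJ.
Qed.

(** * Evolution equations over a differential ring *)

Section Evolution.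
Context (dT : {additive A -> A}) (dTM : leibniz dT).
Hypothesis dTC : forall i x, dT (dX i x) = dX i (dT x).
Hypothesis flow : map_mx dT (map_mx dT Y) = H *: nu.

Local Notation t_ u := (map_mx dT u).
Local Notation x_ i u := (map_mx (dX i) u).

Lemma tx_comm i (u : 'rV[A]_n.+1) : t_ (x_ i u) = x_ i (t_ u).
Proof. exact: map_mx_comm. Qed.

Lemma dot_nu_xnu i : dotv (x_ i nu) nu = 0.
Proof. by rewrite dotvE normal_derive_perp ?mx_unit // mxE. Qed.

Lemma dot_nu_tnu : dotv (t_ nu) nu = 0.
Proof. by rewrite dotvE normal_derive_perp ?mx_unit // mxE. Qed.

Lemma dot_flow_x m k : dotv (x_ m (H *: nu)) (Y_ k) = - (H * h m k).
Proof.
rewrite map_mx_leibnizZ // dotvDl !dotvZl nu_perp mulr0 add0r.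
rewrite mxE -mulrN; congr (_ * _).
have := leibniz_dotv (dXM m) nu (Y_ k); rewrite nu_perp raddf0.
by move/esym/eqP; rewrite addr_eq0 => /eqP ->; rewrite dotvC.
Qed.

Lemma metric_evolution i j :
  dT (dT (dotv (Y_ i) (Y_ j)))
  = - (2 * H * h i j) + 2 * dotv (t_ (Y_ i)) (t_ (Y_ j)).
Proof.
rewrite !(leibniz_dotv dTM) raddfD /= !(leibniz_dotv dTM) !tx_comm flow.
rewrite dot_flow_x [dotv (Y_ i) (x_ _ _)]dotvC dot_flow_x (h_sym j i).
ring.
Qed.

Local Notation w i := (dotv nu (t_ (Y_ i))).

Lemma tnu_frame m : dotv (t_ nu) (Y_ m) = - w m.
Proof.
have := leibniz_dotv dTM nu (Y_ m); rewrite nu_perp raddf0.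
by move/esym/eqP; rewrite addr_eq0 => /eqP.
Qed.

Lemma tnu_expand : t_ nu = - \sum_i \sum_j (gi i j * w i) *: Y_ j.
Proof.
apply: frame_ext => [m|]; first by rewrite tnu_frame dotvNl raise_frame.
by rewrite dot_nu_tnu dotvNl raise_perp oppr0.
Qed.

Lemma dot_tnu_tnu : dotv (t_ nu) (t_ nu) = \sum_i \sum_j gi i j * w i * w j.
Proof.
rewrite {1}tnu_expand dotvNl dotv_suml -sumrN; apply: eq_bigr => i _.
rewrite dotv_suml -sumrN; apply: eq_bigr => j _.
by rewrite dotvZl [dotv (Y_ j) _]dotvC tnu_frame mulrN opprK.
Qed.

Lemma ttnu_nu : dotv (t_ (t_ nu)) nu = - dotv (t_ nu) (t_ nu).
Proof.
have := leibniz_dotv dTM (t_ nu) nu; rewrite dot_nu_tnu raddf0.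
by move/esym/eqP; rewrite addr_eq0 => /eqP.
Qed.

(** Differentiate the orthogonality of [nu] and [Y_ m] twice in time. By the
    flow, the second time derivative of [Y_ m] is the [x^m]-derivative of
    [H *: nu], whose normal component is the derivative of [H]. *)
Lemma ttnu_frame m :
  dotv (t_ (t_ nu)) (Y_ m) = - (2 * dotv (t_ nu) (t_ (Y_ m))) - dX m H.
Proof.
have := leibniz_dotv dTM (t_ nu) (Y_ m); rewrite tnu_frame raddfN /=.
rewrite (leibniz_dotv dTM) [t_ (Y_ m)]tx_comm.
rewrite [t_ (x_ m _)]tx_comm flow map_mx_leibnizZ //.
rewrite [dotv nu (_ + _)]dotvC dotvDl !dotvZl nu_unit dot_nu_xnu => e.
have {e} := congr1 (fun x => x - dotv (t_ nu) (x_ m (t_ Y))) e.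
by rewrite addrK => <-; ring.
Qed.

(** Both sides have the same inner products with the frame: the tangential ones
    are [ttnu_frame] with the first time derivative of [nu] expanded, the normal
    one is minus the squared length of that derivative. *)
Lemma normal_evolution :
  t_ (t_ nu) = - (\sum_i \sum_j (gi i j * dX i H) *: Y_ j)
    + \sum_i \sum_j (gi i j * w i) *:
       (\sum_k \sum_l (2 * gi k l * dotv (Y_ j) (t_ (Y_ l))) *: Y_ k
        + \sum_k \sum_l (gi k l * dotv (Y_ l) (t_ (Y_ j))) *: Y_ k
        - t_ (Y_ j)).
Proof.
apply: frame_ext => [m|].
  rewrite ttnu_frame dotvDl dotvNl raise_frame {1}tnu_expand dotvNl mulrN opprK.
  rewrite addrC; congr (_ + _); rewrite !dotv_suml mulr_sumr.
  apply: eq_bigr => i _; rewrite !dotv_suml mulr_sumr; apply: eq_bigr => j _.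
  rewrite !dotvZl !dotvDl dotvNl raise_frame_sym.
  have -> : \sum_k \sum_l (2 * gi k l * dotv (Y_ j) (t_ (Y_ l))) *: Y_ k
      = \sum_k \sum_l (gi k l * (2 * dotv (Y_ j) (t_ (Y_ l)))) *: Y_ k.
    apply: eq_bigr => k _; apply: eq_bigr => l _; congr (_ *: _); ring.
  by rewrite raise_frame_sym [dotv (t_ (Y_ j)) _]dotvC; ring.
rewrite ttnu_nu dot_tnu_tnu dotvDl dotvNl raise_perp oppr0 add0r.
rewrite dotv_suml -sumrN; apply: eq_bigr => i _.
rewrite dotv_suml -sumrN; apply: eq_bigr => j _.
by rewrite dotvZl !dotvDl dotvNl !raise_perp !add0r mulrN [dotv nu (t_ (Y_ j))]dotvC.
Qed.

Lemma dot_xxnu i j : dotv (x_ i (x_ j nu)) nu = - B i j.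
Proof.
have := leibniz_dotv (dXM i) (x_ j nu) nu; rewrite dot_nu_xnu raddf0.
move/esym/eqP; rewrite addr_eq0 => /eqP ->; congr (- _).
rewrite dotvE !(weingarten mx_unit mx_perp mx_dual_perp mx_dual two_reg) //.
rewrite raddfN /= mulmxN mulNmx opprK [(_ *m E)^T]trmx_mul trmxK.
transitivity (((shp (dX j))^T *m gi *m shp (dX i)) 0 0).
  by rewrite -[in RHS]mx_dual_gram !mulmxA.
rewrite B_sym [LHS]mxE [RHS]mxE; apply: eq_bigr => k _.
by rewrite h_row_mul -h_shape h_sym.
Qed.

Lemma gauss_formula i j : x_ i (Y_ j) = \sum_k G i j k *: Y_ k + h i j *: nu.
Proof.
rewrite -derive_frame_row (frame_derive mx_unit mx_perp mx_dual_perp mx_dual) raddfD /=.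
congr (_ + _).
  rewrite row_mul mulmx_sum_row; apply: eq_bigr => k _.
  by rewrite row_tangent mxE.
rewrite row_mul h_shape; apply/rowP => a.
by rewrite mxE big_ord1 !mxE.
Qed.

(** Differentiate [h i j = (x_ i (Y_ j), nu)] twice in time. The flow turns the
    term with all derivatives on [Y] into the second derivative of [H] minus
    [H] times the square of [h]; in the other terms [x_ i (Y_ j)] is replaced by
    its Gauss decomposition. The terms with [G] and the mixed derivatives of [Y]
    cancel, and the remaining derivatives of [H] form its Hessian, which Simons'
    identity trades for the Laplacian of [h]. *)
Lemma second_form_evolution i j :
  dT (dT (h i j))
  = \sum_k \sum_l gi k l * nabla2_h k l i j
    - 2 * H * B i j
    + \tr (gi *m B) * h i j
    + \sum_k \sum_l gi k l * h i j * w k * w l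
    - 2 * \sum_k dT (G i j k) * w k.
Proof.
rewrite simons.
have ttY : dotv (t_ (t_ (x_ i (Y_ j)))) nu = dX i (dX j H) - H * B i j.
  rewrite tx_comm [t_ (x_ i _)]tx_comm [t_ (Y_ j)]tx_comm tx_comm flow.
  rewrite map_mx_leibnizZ // raddfD /= !map_mx_leibnizZ // !dotvDl !dotvZl.
  by rewrite !dot_nu_xnu dot_xxnu nu_unit; ring.
have tYt : dotv (t_ (x_ i (Y_ j))) (t_ nu) = - (\sum_k dT (G i j k) * w k)
    + \sum_k G i j k * dotv (t_ (Y_ k)) (t_ nu)
    + h i j * dotv (t_ nu) (t_ nu).
  rewrite gauss_formula raddfD /= map_mx_leibnizZ // !dotvDl !dotvZl.
  rewrite [dotv nu _]dotvC dot_nu_tnu mulr0 add0r raddf_sum /= dotv_suml.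
  rewrite -sumrN -big_split /=; congr (_ + _); apply: eq_bigr => k _.
  rewrite map_mx_leibnizZ // dotvDl !dotvZl [dotv (Y_ k) _]dotvC tnu_frame.
  by rewrite mulrN.
have Ytt : dotv (x_ i (Y_ j)) (t_ (t_ nu))
    = - 2 * (\sum_k G i j k * dotv (t_ (Y_ k)) (t_ nu))
      - \sum_k G i j k * dX k H - h i j * dotv (t_ nu) (t_ nu).
  rewrite gauss_formula dotvDl dotvZl [dotv nu _]dotvC ttnu_nu mulrN.
  congr (_ + _); rewrite dotv_suml mulr_sumr -sumrB; apply: eq_bigr => k _.
  by rewrite dotvZl dotvC ttnu_frame [dotv (t_ nu) _]dotvC; ring.
have -> : \sum_k \sum_l gi k l * h i j * w k * w l = h i j * dotv (t_ nu) (t_ nu).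
  rewrite dot_tnu_tnu mulr_sumr; apply: eq_bigr => k _; rewrite mulr_sumr.
  by apply: eq_bigr => l _; ring.
have hE : h i j = dotv (x_ i (Y_ j)) nu by rewrite mxE.
rewrite [in LHS]hE !(leibniz_dotv dTM) raddfD /= !(leibniz_dotv dTM) ttY tYt Ytt.
ring.
Qed.

End Evolution.
End Hypersurface.

(** * Smooth functions on an open set *)

(** The chosen differential of [f] satisfies the defining expansion for [g] too,
    and the differential is unique. *)
Lemma near_eq_differentiable (R : realType) (V W : normedModType R)
    (f g : V -> W) (p : V) :
  (\near p, f p = g p) -> differentiable f p -> differentiable g p.
Proof.
move=> fg df.
have e : g \o shift p = cst (g p) + 'd f p +o_ 0 id.
  apply/eqaddoP => _/posnumP[e].
  have /diff_locally/eqaddoP/(_ e%:num [gt0 of e%:num]) := df.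
  rewrite -(nbhs_singleton fg); apply: filter_app.
  have : \forall x \near 0, f (x + p) = g (x + p).
    by have := fg; rewrite (near_shift 0) /=; apply: filterS => x /=; rewrite subr0.
  by apply: filterS => x /= fgx; rewrite -![(_ + _ : _ -> _) _]/(_ + _) /= fgx.
have dfc := diff_continuous df.
by apply/diff_locallyP; rewrite (diff_unique dfc e).
Qed.

Section SmoothClosure.
Context {R : realType} {V : normedModType R} (D : set V).
Hypothesis D_open : open D.

Lemma near_open (W : Type) (f g : V -> W) p :
  D p -> (forall x, D x -> f x = g x) -> \near p, f p = g p.
Proof.
move=> Dp fg; have : nbhs p D by apply: open_nbhs_nbhs; split.
by apply: filterS => x /fg.
Qed.

Lemma eq_on_derive (W : normedModType R) (f g : V -> W) v p :
  (forall x, D x -> f x = g x) -> D p -> 'D_v f p = 'D_v g p.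
Proof. by move=> fg Dp; apply: near_eq_derive; apply: near_open. Qed.

Lemma smooth_on_differentiable (W : normedModType R) (f : V -> W) p :
  smooth_on D f -> D p -> differentiable f p.
Proof. by move=> fs Dp; exact: fs [::] p Dp. Qed.

Lemma smooth_on_derive (W : normedModType R) (f : V -> W) v :
  smooth_on D f -> smooth_on D ('D_v f).
Proof. by move=> fs vs p Dp; have := fs (rcons vs v) p Dp; rewrite foldr_rcons. Qed.

(** The innermost directional derivative is peeled off first, so a class of
    differentiable functions stable under directional derivatives consists of
    smooth functions. *)
Lemma smooth_on_coind (W : normedModType R) (P : (V -> W) -> Prop) :
  (forall f p, P f -> D p -> differentiable f p) ->
  (forall f v, P f -> P ('D_v f)) ->
  forall f, P f -> smooth_on D f.
Proof.
move=> Pdiff Pder f Pf vs p Dp.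
elim/last_ind: vs f Pf => [|vs v IH] f Pf; first exact: Pdiff.
by rewrite foldr_rcons; exact/IH/Pder.
Qed.

(** The class to which [smooth_on_coind] is applied: a product of smooth
    functions has a derivative that is a sum of products, hence the closure under
    all ring operations at once, and under changes outside [D], where the
    derivation rules may fail. *)
Inductive smooth_expr : (V -> R^o) -> Prop :=
| expr_base (f : V -> R^o) : smooth_on D f -> smooth_expr f
| expr_cst (c : R) : smooth_expr (fun=> c)
| expr_add f g : smooth_expr f -> smooth_expr g -> smooth_expr (fun x => f x + g x)
| expr_mul f g : smooth_expr f -> smooth_expr g -> smooth_expr (fun x => f x * g x)
| expr_inv f : smooth_expr f -> (forall x, D x -> f x != 0) ->
    smooth_expr (fun x => (f x)^-1)
| expr_eq f g : smooth_expr f -> (forall x, D x -> f x = g x) -> smooth_expr g.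

Lemma smooth_expr_differentiable f p : smooth_expr f -> D p -> differentiable f p.
Proof.
move=> sf Dp; elim: sf => {f}.
- by move=> f sf; exact: smooth_on_differentiable.
- by move=> c; exact: differentiable_cst.
- by move=> f g _ fd _ gd; exact: differentiableD.
- by move=> f g _ fd _ gd; exact: differentiableM.
- by move=> f _ fd f0; apply: differentiableV => //; exact: f0.
- by move=> f g _ fd fg; apply: near_eq_differentiable fd; exact: near_open.
Qed.

Lemma smooth_expr_derive f v : smooth_expr f -> smooth_expr ('D_v f).
Proof.
have diff := smooth_expr_differentiable.
elim => {f}.
- by move=> f sf; apply: expr_base; exact: smooth_on_derive.
- move=> c; apply: expr_eq (expr_cst 0) _ => x Dx; exact/esym/derive_cst.
- move=> f g sf df sg dg; apply: expr_eq (expr_add df dg) _ => x Dx.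
  by apply/esym/deriveD; apply: diff_derivable; exact: diff.
- move=> f g sf df sg dg.
  apply: expr_eq (expr_add (expr_mul df sg) (expr_mul sf dg)) _ => x Dx.
  rewrite [RHS]deriveM ?[_ *: _]mulrC; try by apply: diff_derivable; exact: diff.
  by rewrite addrC; congr (_ + _); rewrite mulrC.
- move=> f sf df f0; have sVf := expr_inv sf f0.
  apply: expr_eq (expr_mul (expr_cst (-1)) (expr_mul (expr_mul sVf sVf) df)) _ => x Dx.
  rewrite [RHS]deriveV; [|exact: f0|by apply: diff_derivable; exact: diff].
  by rewrite mulN1r scaleNr expr2 invfM.
- move=> f g sf df fg; apply: expr_eq df _ => x Dx; exact: eq_on_derive.
Qed.

Lemma smooth_exprP f : smooth_expr f -> smooth_on D f.
Proof.
apply: smooth_on_coind => {}f; first exact: smooth_expr_differentiable.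
exact: smooth_expr_derive.
Qed.

End SmoothClosure.

Section Schwarz.
Context {R : realType} {V : normedModType R}.
Implicit Types (f : V -> R^o).

Lemma line_is_derive f (q v : V) (s : R) : differentiable f (q + s *: v) ->
  is_derive s 1 (fun s : R => f (q + s *: v) : R) ('D_v f (q + s *: v)).
Proof.
move=> fd.
have e : (fun h : R => h^-1 *: (((fun s : R => f (q + s *: v)) \o shift s) (h *: 1) - f (q + s *: v)))
    = (fun h : R => h^-1 *: ((f \o shift (q + s *: v)) (h *: v) - f (q + s *: v))).
  apply/funext => h /=; congr (_ *: (f _ - _)).
  by rewrite [h *: 1]mulr1 scalerDl addrCA.
split; first by rewrite /derivable e; exact: diff_derivable.
by rewrite /derive e.
Qed.

Lemma line_MVT f (q v : V) (h : R) : 0 < h ->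
  (forall s, 0 <= s <= h -> differentiable f (q + s *: v)) ->
  exists2 s, 0 <= s <= h & f (q + h *: v) - f q = h * 'D_v f (q + s *: v).
Proof.
move=> h0 fd.
have [x|s|s] := @MVT R (fun s => f (q + s *: v)) (fun s => 'D_v f (q + s *: v)) 0 h h0.
- rewrite in_itv /= => /andP[x0 xh]; apply: line_is_derive; apply: fd.
  by rewrite !ltW.
- apply: derivable_within_continuous => x; rewrite in_itv /= => xh.
  by have [] := line_is_derive (fd x xh).
rewrite in_itv /= scale0r addr0 subr0 => /andP[s0 sh] ->.
by exists s; rewrite ?(ltW s0) ?ltW // mulrC.
Qed.

Lemma derive_shift_comp f (c x v : V) :
  'D_v (fun y => f (y + c)) x = 'D_v f (x + c).
Proof.
rewrite /derive.
suff -> : (fun h : R => h^-1 *: (((fun y => f (y + c)) \o shift x) (h *: v) - f (x + c)))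
  = (fun h : R => h^-1 *: ((f \o shift (x + c)) (h *: v) - f (x + c))) by [].
by apply/funext => k /=; rewrite addrA.
Qed.

(** The mean value theorem along [v], applied to the increment of [f] by
    [h *: w], and then along [w], applied to the [v]-derivative of [f]. *)
Lemma second_difference (D : set V) f (p v w : V) (h : R) : open D -> 0 < h ->
  smooth_on D f ->
  (forall s t, 0 <= s <= h -> 0 <= t <= h -> D (p + s *: v + t *: w)) ->
  exists s t, [/\ 0 <= s <= h, 0 <= t <= h &
    f (p + h *: v + h *: w) - f (p + h *: v) - (f (p + h *: w) - f p)
    = h * (h * 'D_w ('D_v f) (p + s *: v + t *: w))].
Proof.
move=> Dopen h0 fs Dst.
have h0h : 0 <= h <= h by rewrite ltW ?lexx.
have z0h : 0 <= (0 : R) <= h by rewrite lexx ltW.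
have fd x : D x -> differentiable f x by exact: smooth_on_differentiable.
have fdw x : D x -> differentiable ('D_v f) x.
  exact/smooth_on_differentiable/smooth_on_derive.
pose g : V -> R^o := fun x => f (x + h *: w) - f x.
have gd s : 0 <= s <= h -> differentiable g (p + s *: v).
  move=> sh; apply: differentiableB; last first.
    by apply: fd; have := Dst s 0 sh z0h; rewrite scale0r addr0.
  apply: (@differentiable_comp _ _ _ _ (fun x => x + h *: w) f) => //.
  exact/fd/Dst.
have [s sh gs] := line_MVT h0 gd.
have ds t : 0 <= t <= h -> differentiable ('D_v f) (p + s *: v + t *: w).
  by move=> th; apply/fdw/Dst.
have [t th ft] := line_MVT h0 ds.
exists s, t; split=> //; rewrite -ft.
move: gs; rewrite /g => ->; congr (_ * _).
rewrite [LHS]deriveB; last 2 first.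
- apply: diff_derivable; apply: (@differentiable_comp _ _ _ _ (fun x => x + h *: w) f) => //.
  exact/fd/Dst.
- by apply/diff_derivable/fd; have := Dst s 0 sh z0h; rewrite scale0r addr0.
by rewrite derive_shift_comp.
Qed.

(** The second difference of [f] is symmetric in [v] and [w], so by
    [second_difference] the two mixed derivatives agree at points arbitrarily
    close to [p]; they are continuous. *)
Lemma schwarz (D : set V) f (p v w : V) : open D -> smooth_on D f -> D p ->
  'D_v ('D_w f) p = 'D_w ('D_v f) p.
Proof.
move=> Dopen fs Dp.
pose a : V -> R^o := 'D_v ('D_w f); pose b : V -> R^o := 'D_w ('D_v f).
have ca : {for p, continuous a}.
  apply: differentiable_continuous; apply: smooth_on_differentiable Dp.
  by do 2!apply: smooth_on_derive.
have cb : {for p, continuous b}.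
  apply: differentiable_continuous; apply: smooth_on_differentiable Dp.
  by do 2!apply: smooth_on_derive.
apply/eqP; rewrite -subr_eq0 -normr_le0; apply/ler_addgt0Pr => e e0.
rewrite add0r.
have e2 : 0 < e / 2 by rewrite divr_gt0.
have /nbhs_ballP[r /= r0 rP] : nbhs p [set q | [/\ D q, `|a p - a q| < e / 2 & `|b p - b q| < e / 2]].
  have nD : nbhs p D by apply: open_nbhs_nbhs; split.
  have na : \forall q \near p, `|a p - a q| < e / 2.
    by move/cvgrPdist_lt: ca; apply.
  have nb : \forall q \near p, `|b p - b q| < e / 2.
    by move/cvgrPdist_lt: cb; apply.
  by apply: filterS3 nD na nb => q.
(* Small enough for the parallelograms with sides [h *: v] and [h *: w] at [p]
   to stay in the ball of radius [r]. *)
pose h := r / 2 / (1 + `|v| + `|w|).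
have n0 : 0 < 1 + `|v| + `|w| by rewrite -addrA ltr_pwDl // addr_ge0.
have h0 : 0 < h by rewrite !divr_gt0.
have inr (x y : V) s t : x = v /\ y = w \/ x = w /\ y = v ->
    0 <= s <= h -> 0 <= t <= h -> ball p r (p + s *: x + t *: y).
  move=> xy /andP[s0 sh] /andP[t0 th]; rewrite -ball_normE /ball_ /=.
  rewrite -addrA opprD addrA subrr add0r normrN.
  apply: le_lt_trans (ler_normD _ _) _; rewrite !normrZ !ger0_norm //.
  have xys : `|x| + `|y| = `|v| + `|w| by case: xy => -[-> ->] //; rewrite addrC.
  apply: (@le_lt_trans _ _ (h * (`|x| + `|y|))).
    by rewrite mulrDr lerD // ler_wpM2r.
  rewrite xys; apply: (@le_lt_trans _ _ (r / 2)); last by rewrite ltr_pdivrMr // ltr_pMr // ltr1n.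
  rewrite /h -mulrA ler_piMr ?divr_ge0 ?ltW // mulrC ltr_pdivrMr // mul1r.
  by rewrite -addrA ltrDr.
have Dvw s t : 0 <= s <= h -> 0 <= t <= h -> D (p + s *: v + t *: w).
  by move=> sh th; have [] := rP _ (inr v w s t (or_introl (conj erefl erefl)) sh th).
have Dwv s t : 0 <= s <= h -> 0 <= t <= h -> D (p + s *: w + t *: v).
  by move=> sh th; have [] := rP _ (inr w v s t (or_intror (conj erefl erefl)) sh th).
have [s [t [sh th e1]]] := second_difference Dopen h0 fs Dvw.
have [s' [t' [sh' th' e1']]] := second_difference Dopen h0 fs Dwv.
set q := p + s *: v + t *: w in e1.
set q' := p + s' *: w + t' *: v in e1'.
have [_ _ bq] := rP _ (inr v w s t (or_introl (conj erefl erefl)) sh th).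
have [_ aq _] := rP _ (inr w v s' t' (or_intror (conj erefl erefl)) sh' th').
have ab : a q' = b q.
  apply: (mulfI (lt0r_neq0 h0)); apply: (mulfI (lt0r_neq0 h0)).
  apply: (etrans (esym e1') (etrans _ e1)); rewrite (addrAC p (h *: w)).
  move: (f _) (f (p + h *: w)) (f (p + h *: v)) (f p) => x1 x2 x3 x4.
  by rewrite !opprB !addrA addrAC [RHS]addrAC; congr (_ + _); rewrite addrAC.
change (`|a p - b p| <= e).
have -> : a p - b p = (a p - a q') + (b q - b p) by rewrite -ab addrA subrK.
apply: (le_trans (ler_normD _ _)); rewrite (splitr e).
by apply: lerD; apply: ltW; [exact: aq | rewrite distrC; exact: bq].
Qed.

End Schwarz.

(** * The differential ring of smooth functions on an open set *)

(** Nonemptiness makes the ring of smooth functions nontrivial. *)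
Record region (R : realType) (V : normedModType R) := Region {
  region_set :> V -> Prop;
  region_open : @open V region_set;
  region_nonempty : exists x, region_set x
}.

(** Vanishing outside [U] makes agreement on [U] an equality of functions, so
    that identities valid on [U] can be rewritten under further derivatives. *)
Record smfun (R : realType) (V : normedModType R) (U : region V) := SmoothFun {
  smfun_val :> V -> R^o;
  smfun_smooth : smooth_on U smfun_val;
  smfun_out : forall x, ~ U x -> smfun_val x = 0
}.

Section SmoothFun.
Context {R : realType} {V : normedModType R} {U : region V}.
Implicit Types a b c : smfun U.

Lemma smfunP a b : (forall x, U x -> a x = b x) -> a = b.
Proof.
move=> ab; have : smfun_val a = smfun_val b.
  apply/funext => x; have [Ux|nUx] := pselect (U x); first exact: ab.
  by rewrite !smfun_out.
case: a b {ab} => [f fs fo] [g gs go] /= fg.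
by move: gs go; rewrite -fg => gs go; congr SmoothFun; exact: Prop_irrelevance.
Qed.

Definition cut (f : V -> R^o) : V -> R^o :=
  fun x => if pselect (U x : Prop) then f x else 0.

Lemma cutE f x : U x -> cut f x = f x.
Proof. by rewrite /cut; case: pselect. Qed.

Lemma cut_out f x : ~ U x -> cut f x = 0.
Proof. by rewrite /cut; case: pselect. Qed.

Lemma cut_smooth f : smooth_expr U f -> smooth_on U (cut f).
Proof.
move=> sf; apply: smooth_exprP; first exact: region_open.
by apply: expr_eq sf _ => x Ux; rewrite cutE.
Qed.

Definition to_smfun f (sf : smooth_expr U f) : smfun U :=
  SmoothFun (cut_smooth sf) (@cut_out f).

Lemma to_smfunE f (sf : smooth_expr U f) x : U x -> to_smfun sf x = f x.
Proof. exact: cutE. Qed.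

Let gen a : smooth_expr U a := expr_base (@smfun_smooth _ _ _ a).

Definition smfun_zero := to_smfun (expr_cst U 0).
Definition smfun_one := to_smfun (expr_cst U 1).
Definition smfun_opp a := to_smfun (expr_mul (expr_cst U (-1)) (gen a)).
Definition smfun_add a b := to_smfun (expr_add (gen a) (gen b)).
Definition smfun_mul a b := to_smfun (expr_mul (gen a) (gen b)).

Let sE := (to_smfunE, mulN1r).

Fact smfun_addA : associative smfun_add.
Proof. by move=> a b c; apply: smfunP => x Ux; rewrite !sE // addrA. Qed.
Fact smfun_addC : commutative smfun_add.
Proof. by move=> a b; apply: smfunP => x Ux; rewrite !sE // addrC. Qed.
Fact smfun_add0 : left_id smfun_zero smfun_add.
Proof. by move=> a; apply: smfunP => x Ux; rewrite !sE // add0r. Qed.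
Fact smfun_addN : left_inverse smfun_zero smfun_opp smfun_add.
Proof. by move=> a; apply: smfunP => x Ux; rewrite !sE // addNr. Qed.
Fact smfun_mulA : associative smfun_mul.
Proof. by move=> a b c; apply: smfunP => x Ux; rewrite !sE // mulrA. Qed.
Fact smfun_mulC : commutative smfun_mul.
Proof. by move=> a b; apply: smfunP => x Ux; rewrite !sE // mulrC. Qed.
Fact smfun_mul1 : left_id smfun_one smfun_mul.
Proof. by move=> a; apply: smfunP => x Ux; rewrite !sE // mul1r. Qed.
Fact smfun_mulD : left_distributive smfun_mul smfun_add.
Proof. by move=> a b c; apply: smfunP => x Ux; rewrite !sE // mulrDl. Qed.

HB.instance Definition _ := gen_eqMixin (smfun U).
HB.instance Definition _ := gen_choiceMixin (smfun U).

Fact smfun_one_neq0 : smfun_one != smfun_zero.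
Proof.
apply/eqP => /(congr1 (@smfun_val _ _ _)) e.
have [x Ux] := region_nonempty U.
have := congr1 (fun f : V -> R^o => f x) e; rewrite !sE // => /eqP.
by rewrite oner_eq0.
Qed.

HB.instance Definition _ :=
  GRing.isZmodule.Build (smfun U) smfun_addA smfun_addC smfun_add0 smfun_addN.
HB.instance Definition _ := GRing.Zmodule_isComNzRing.Build (smfun U)
  smfun_mulA smfun_mulC smfun_mul1 smfun_mulD smfun_one_neq0.

Definition smfun_at (x : {x | U x}) a : R := a (proj1_sig x).

Fact smfun_at_zmod (x : {x | U x}) : zmod_morphism (smfun_at x).
Proof.
case: x => x Ux a b; change (smfun_add a (smfun_opp b) x = a x - b x).
by rewrite !sE.
Qed.

Fact smfun_at_monoid (x : {x | U x}) : monoid_morphism (smfun_at x).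
Proof.
case: x => x Ux; split=> [|a b]; first exact: to_smfunE.
by change (smfun_mul a b x = a x * b x); rewrite !sE.
Qed.

HB.instance Definition _ x :=
  GRing.isZmodMorphism.Build (smfun U) R (smfun_at x) (smfun_at_zmod x).
HB.instance Definition _ x :=
  GRing.isMonoidMorphism.Build (smfun U) R (smfun_at x) (smfun_at_monoid x).

Lemma smfunD a b x : U x -> (a + b) x = a x + b x.
Proof. by move=> Ux; exact: (rmorphD (smfun_at (exist _ x Ux))). Qed.

Lemma smfunB a b x : U x -> (a - b) x = a x - b x.
Proof. by move=> Ux; exact: (rmorphB (smfun_at (exist _ x Ux))). Qed.

Lemma smfunM a b x : U x -> (a * b) x = a x * b x.
Proof. by move=> Ux; exact: (rmorphM (smfun_at (exist _ x Ux))). Qed.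

Lemma smfun_at_inj a b : (forall x, smfun_at x a = smfun_at x b) -> a = b.
Proof. by move=> ab; apply: smfunP => x Ux; exact: (ab (exist _ x Ux)). Qed.

Definition sder (v : V) a : smfun U :=
  to_smfun (smooth_expr_derive (region_open U) v (gen a)).

Lemma sderE v a x : U x -> sder v a x = 'D_v a x.
Proof. exact: to_smfunE. Qed.

Lemma smfun_diff a x : U x -> differentiable a x.
Proof. exact/smooth_on_differentiable/smfun_smooth. Qed.

Lemma smfun_derivable a v x : U x -> derivable a x v.
Proof. by move=> Ux; apply: diff_derivable; exact: smfun_diff. Qed.

Lemma eq_sder v a (f : V -> R^o) x :
  (forall y, U y -> f y = a y) -> U x -> 'D_v f x = sder v a x.
Proof.
by move=> fa Ux; rewrite sderE //; apply: eq_on_derive Ux => //; exact: region_open.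
Qed.

Fact sder_zmod v : zmod_morphism (sder v).
Proof.
move=> a b; apply: smfunP => x Ux.
rewrite smfunB // !sderE // -deriveB; try exact: smfun_derivable.
by apply: eq_on_derive Ux; [exact: region_open|move=> y Uy; exact: smfunB].
Qed.

HB.instance Definition _ v :=
  GRing.isZmodMorphism.Build (smfun U) (smfun U) (sder v) (sder_zmod v).

Lemma sder_leibniz v : leibniz (sder v).
Proof.
move=> a b; apply: smfunP => x Ux.
rewrite smfunD // !smfunM // !sderE //.
rewrite (eq_on_derive (region_open U) (g := (a : V -> R^o) * (b : V -> R^o)) v _ Ux);
  last by move=> y Uy; rewrite smfunM.
rewrite deriveM; try exact: smfun_derivable.
by rewrite addrC; congr (_ + _); rewrite [RHS]mulrC.
Qed.

Lemma sder_comm v w a : sder v (sder w a) = sder w (sder v a).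
Proof.
apply: smfunP => x Ux.
have D1 u y : U y -> 'D_u a y = sder u a y by move=> Uy; rewrite sderE.
have e1 : 'D_v ('D_w a) x = sder v (sder w a) x by apply: eq_sder => // y /(D1 w).
have e2 : 'D_w ('D_v a) x = sder w (sder v a) x by apply: eq_sder => // y /(D1 v).
apply: etrans (esym e1) (etrans _ e2).
exact: schwarz (region_open U) (@smfun_smooth _ _ _ a) Ux.
Qed.

Lemma smfun_double a : a + a = 0 -> a = 0.
Proof.
move=> a0; apply: smfun_at_inj => x; rewrite rmorph0.
have := congr1 (smfun_at x) a0; rewrite rmorph0 rmorphD /= => /eqP.
by rewrite -mulr2n mulrn_eq0 => /eqP.
Qed.

Lemma smfun_inv a : (forall x, U x -> a x != 0) -> exists b, b * a = 1.
Proof.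
move=> a0; exists (to_smfun (expr_inv (gen a) a0)).
by apply: smfunP => x Ux; rewrite !sE // mulVf // a0.
Qed.

(** Agreement is only asked on [U]; as [U] is open, it passes to derivatives. *)
Definition represents (f : V -> R^o) a := forall x (Ux : U x), f x = smfun_at (exist _ x Ux) a.

Definition vec_represents m (F : V -> 'rV[R]_m) (u : 'rV[smfun U]_m) :=
  forall x (Ux : U x), F x = map_mx (smfun_at (exist _ x Ux)) u.

Lemma represents_derive v f a : represents f a -> represents ('D_v f) (sder v a).
Proof. by move=> fa x Ux; exact: eq_sder. Qed.

Lemma vec_represents_derive m v F (u : 'rV[smfun U]_m.+1) :
  vec_represents F u -> vec_represents ('D_v F) (map_mx (sder v) u).
Proof.
move=> Fu x Ux.
have Fij i j y : U y -> F y i j = u 0 j y.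
  by move=> Uy; rewrite (Fu y Uy) mxE ord1.
have Fd : derivable F x v.
  apply/derivable_mxP => i j.
  apply: (@near_eq_derivable _ _ _ (u 0 j : V -> R^o)); last exact: smfun_derivable.
  by apply: (near_open (region_open U) Ux) => y Uy; rewrite Fij.
rewrite derive_mx //; apply/rowP => j; rewrite !mxE.
by apply: eq_sder => // y Uy; exact: Fij.
Qed.

Lemma vec_represents_exists m (F : V -> 'rV[R]_m.+1) :
  smooth_on U F -> exists u, vec_represents F u.
Proof.
move=> Fs.
have Fj j : smooth_expr U (fun x => F x 0 j : R^o).
  apply: expr_base.
  pose P (f : V -> R^o) := exists2 G : V -> 'rV[R]_m.+1, smooth_on U G &
    forall x, U x -> G x 0 j = f x.
  apply: (@smooth_on_coind _ _ _ _ P); last by exists F.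
    move=> f p [G Gs Gf] Up; apply: (@near_eq_differentiable _ _ _ (fun x => G x 0 j : R^o)).
      exact: (@near_open _ _ _ (region_open U) R^o (fun x => G x 0 j) f p Up Gf).
    apply: (@differentiable_comp _ _ _ _ G (fun N : 'rV[R]_m.+1 => N 0 j : R^o)).
      exact: smooth_on_differentiable Gs Up.
    exact: differentiable_coord.
  move=> f v [G Gs Gf]; exists ('D_v G); first exact: smooth_on_derive.
  move=> x Ux; rewrite derive_mx; last by apply/diff_derivable; exact: smooth_on_differentiable Gs Ux.
  by rewrite mxE; apply: eq_on_derive Ux => //; exact: region_open.
exists (\row_j to_smfun (Fj j)) => x Ux; apply/rowP => j.
by rewrite !mxE /smfun_at to_smfunE.
Qed.

End SmoothFun.

Arguments smfun_at : simpl never.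
Arguments sder : simpl never.

(** * Transfer to a family of immersions *)

(** A kernel vector [w] of the Gram matrix makes [w *m J] a vector of length
    zero, and the rows of [J] are independent. *)
Lemma gram_unit (F : realFieldType) m n (J : 'M[F]_(m, n)) :
  row_free J -> J *m J^T \in unitmx.
Proof.
move=> Jfree; rewrite -row_free_unit -kermx_eq0; apply/eqP/row_matrixP => i.
rewrite row0; have /sub_kermxP := row_sub i (kermx (J *m J^T)).
move: (row i _) => w; rewrite mulmxA => wJJ.
have /eqP : dotv (w *m J) (w *m J) = 0.
  by rewrite dotvE trmx_mul mulmxA wJJ mul0mx mxE.
rewrite psumr_eq0 => [|a _]; last by rewrite -expr2 sqr_ge0.
move=> /allP wJ0; apply: (row_free_inj Jfree); rewrite mul0mx.
apply/rowP => a; rewrite [RHS]mxE; apply/eqP.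
by have := wJ0 a (mem_index_enum a); rewrite /= -expr2 sqrf_eq0.
Qed.

Section Transfer.
Context {R : realType} {n : nat}.
Local Notation ST := ('rV[R]_n * R^o)%type.
Context (U : region ST).
Variables (Y nu : ST -> 'rV[R]_n.+1).
Hypothesis Y_imm : forall x, U x -> row_free (\matrix_(i < n) dx i Y x).
Hypothesis nu_normal : forall x, U x ->
  inner_prod (nu x) (nu x) = 1 /\ forall i, inner_prod (nu x) (dx i Y x) = 0.
Hypothesis Y_flow : forall x, U x -> dt (dt Y) x = mean_curv Y nu x *: nu x.

Definition sdx (i : 'I_n) : {additive smfun U -> smfun U} :=
  sder ((delta_mx 0 i, 0) : ST).
Definition sdt : {additive smfun U -> smfun U} := sder ((0, 1) : ST).

Arguments sdx : simpl never.
Arguments sdt : simpl never.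

Lemma sdx_leibniz i : leibniz (sdx i). Proof. exact: sder_leibniz. Qed.
Lemma sdt_leibniz : leibniz sdt. Proof. exact: sder_leibniz. Qed.
Lemma sdx_comm i j a : sdx i (sdx j a) = sdx j (sdx i a).
Proof. exact: sder_comm. Qed.
Lemma sdt_comm i a : sdt (sdx i a) = sdx i (sdt a).
Proof. exact: sder_comm. Qed.

Lemma represents_dx i f (a : smfun U) : represents f a -> represents (dx i f) (sdx i a).
Proof. exact: represents_derive. Qed.
Lemma represents_dt f (a : smfun U) : represents f a -> represents (dt f) (sdt a).
Proof. exact: represents_derive. Qed.
Lemma vec_represents_dx i m (F : ST -> 'rV[R]_m.+1) (u : 'rV[smfun U]_m.+1) :
  vec_represents F u -> vec_represents (dx i F) (map_mx (sdx i) u).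
Proof. exact: vec_represents_derive. Qed.
Lemma vec_represents_dt m (F : ST -> 'rV[R]_m.+1) (u : 'rV[smfun U]_m.+1) :
  vec_represents F u -> vec_represents (dt F) (map_mx sdt u).
Proof. exact: vec_represents_derive. Qed.

Lemma smfun_at_dotv x m (a b : 'rV[smfun U]_m) :
  smfun_at x (dotv a b) = inner_prod (map_mx (smfun_at x) a) (map_mx (smfun_at x) b).
Proof.
rewrite raddf_sum; apply: eq_bigr => i _.
by rewrite !mxE; exact: rmorphM.
Qed.

Lemma represents_inner_prod m (F G : ST -> 'rV[R]_m) (a b : 'rV[smfun U]_m) :
  vec_represents F a -> vec_represents G b ->
  represents (fun x => inner_prod (F x) (G x)) (dotv a b).
Proof. by move=> Fa Gb x Ux; rewrite smfun_at_dotv -Fa -Gb. Qed.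

Variables (y v : 'rV[smfun U]_n.+1).
Hypothesis Yy : vec_represents Y y.
Hypothesis nuv : vec_represents nu v.
Local Notation J := (tangent_frame sdx y).
Local Notation g := (J *m J^T).

Lemma represents_metric i j :
  represents (metric Y i j) (dotv (map_mx (sdx i) y) (map_mx (sdx j) y)).
Proof. by apply: represents_inner_prod; exact: vec_represents_dx. Qed.

Lemma metric_at x (Ux : U x) :
  \matrix_(k, l) metric Y k l x = map_mx (smfun_at (exist _ x Ux)) g.
Proof.
by apply/matrixP => i j; rewrite [LHS]mxE [RHS]mxE gram_entry represents_metric.
Qed.

Lemma metric_unit x : U x -> \matrix_(k, l) metric Y k l x \in unitmx.
Proof.
move=> Ux; have := gram_unit (Y_imm Ux); congr (_ \in unitmx).
by apply/matrixP => i j; rewrite !mxE; apply: eq_bigr => a _; rewrite !mxE.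
Qed.

(** The adjugate gives the inverse matrix as soon as the determinant is
    inverted, and a nonvanishing smooth function has a smooth inverse. *)
Lemma smfun_gram_inv : exists gi : 'M[smfun U]_n, gi *m g = 1%:M.
Proof.
have [|b bg] := @smfun_inv _ _ _ (\det g).
  move=> x Ux; change (smfun_at (exist _ x Ux) (\det g) != 0).
  by rewrite -det_map_mx -metric_at -unitfE -unitmxE metric_unit.
by exists (b *: \adj g); rewrite -scalemxAl mul_adj_mx scale_scalar_mx bg.
Qed.

Variable gi : 'M[smfun U]_n.
Hypothesis giK : gi *m g = 1%:M.

Lemma represents_inv_metric i j : represents (inv_metric Y i j) (gi i j).
Proof.
move=> x Ux; rewrite /inv_metric; have gU := metric_unit Ux.
have e : map_mx (smfun_at (exist _ x Ux)) gi *m (\matrix_(k, l) metric Y k l x) = 1%:M.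
  by rewrite metric_at -map_mxM giK map_mx1.
have -> : invmx (\matrix_(k, l) metric Y k l x) = map_mx (smfun_at (exist _ x Ux)) gi.
  by rewrite -[RHS](mulmxK gU) e mul1mx.
by rewrite mxE.
Qed.

Lemma v_unit : dotv v v = 1.
Proof.
apply: smfun_at_inj => -[x Ux]; rewrite rmorph1 smfun_at_dotv -nuv.
by have [] := nu_normal Ux.
Qed.

Lemma v_perp i : dotv v (map_mx (sdx i) y) = 0.
Proof.
apply: smfun_at_inj => -[x Ux]; rewrite rmorph0 smfun_at_dotv -nuv.
by rewrite -(vec_represents_dx i Yy); have [] := nu_normal Ux.
Qed.

Local Notation h := (second_form_mx sdx y v).
Local Notation H := (mean_curvature sdx y v gi).
Local Notation G d := (connection J (gi *m J) d).
Local Notation two_reg := (@smfun_double _ _ U).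

Lemma represents_h i j : represents (second_form Y nu i j) (h i j).
Proof.
rewrite mxE; apply: represents_inner_prod nuv.
by do 2!apply: vec_represents_dx.
Qed.

Lemma represents_H : represents (mean_curv Y nu) H.
Proof.
move=> x Ux; rewrite /mean_curvature (trace_gram giK) rmorph_sum.
apply: eq_bigr => i _; rewrite rmorph_sum; apply: eq_bigr => j _.
by rewrite (represents_inv_metric _ _ Ux) (represents_h _ _ Ux) rmorphM.
Qed.

Lemma represents_christoffel k i j : represents (christoffel Y k i j) (G (sdx i) j k).
Proof.
move=> x Ux; rewrite connE // rmorph_sum /christoffel mulr_sumr.
apply: eq_bigr => l _; rewrite (represents_inv_metric _ _ Ux) rmorphM.
rewrite !(represents_dx _ (represents_metric _ _) Ux) -rmorphD -rmorphB.
rewrite (koszul sdx_leibniz sdx_comm) rmorphM rmorph_nat /= mulrCA; congr (_ * _).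
by rewrite mulrA mulVf ?mul1r // pnatr_eq0.
Qed.

Lemma represents_nabla_h k i j :
  represents (cov_deriv2 Y (second_form Y nu) k i j) (nabla_h sdx y v gi k i j).
Proof.
move=> x Ux; rewrite nabla_hE !rmorphB !rmorph_sum /cov_deriv2.
rewrite (represents_dx _ (represents_h _ _) Ux).
by congr (_ - _ - _); apply: eq_bigr => m _;
  rewrite (represents_christoffel _ _ _ Ux) (represents_h _ _ Ux) rmorphM.
Qed.

Lemma represents_nabla2_h k l i j :
  represents (cov_deriv3 Y (cov_deriv2 Y (second_form Y nu)) k l i j)
    (nabla2_h sdx y v gi k l i j).
Proof.
move=> x Ux; rewrite nabla2_hE !rmorphB !rmorph_sum /cov_deriv3.
rewrite (represents_dx _ (represents_nabla_h _ _ _) Ux).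
by congr (_ - _ - _ - _); apply: eq_bigr => m _;
  rewrite (represents_christoffel _ _ _ Ux) (represents_nabla_h _ _ _ Ux) rmorphM.
Qed.

Lemma smfun_flow : map_mx sdt (map_mx sdt y) = H *: v.
Proof.
apply/rowP => a; apply: smfun_at_inj => -[x Ux].
have := Y_flow Ux.
rewrite (vec_represents_dt (vec_represents_dt Yy) Ux) (represents_H Ux) (nuv Ux).
by move/rowP/(_ a); rewrite !mxE rmorphM.
Qed.

Variables (x : ST) (Ux : U x).
Local Notation ev := (smfun_at (exist _ x Ux)).

Let xY i : dx i Y x = map_mx ev (map_mx (sdx i) y).
Proof. exact: vec_represents_dx. Qed.
Let txY i : dt (dx i Y) x = map_mx ev (map_mx sdt (map_mx (sdx i) y)).
Proof. by apply: vec_represents_dt; exact: vec_represents_dx. Qed.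
Let giE i j : inv_metric Y i j x = ev (gi i j).
Proof. exact: represents_inv_metric. Qed.
Let hE i j : second_form Y nu i j x = ev (h i j).
Proof. exact: represents_h. Qed.
Let HE : mean_curv Y nu x = ev H.
Proof. exact: represents_H. Qed.

Let ipE (F K : 'rV[R]_n.+1) (a b : 'rV[smfun U]_n.+1) :
  F = map_mx ev a -> K = map_mx ev b -> ev (dotv a b) = inner_prod F K.
Proof. by move=> -> ->; exact: smfun_at_dotv. Qed.

Lemma metric_equation i j :
  dt (dt (metric Y i j)) x
  = - (2 * mean_curv Y nu x * second_form Y nu i j x)
    + 2 * inner_prod (dt (dx i Y) x) (dt (dx j Y) x).
Proof.
rewrite (represents_dt (represents_dt (represents_metric i j)) Ux).
rewrite (metric_evolution sdx_leibniz sdx_comm v_perp sdt_leibniz sdt_comm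
  smfun_flow).
rewrite rmorphD rmorphN !rmorphM !rmorph_nat /=.
congr (- (2 * _ * _) + 2 * _); [exact/esym/HE|exact/esym/hE|].
exact: ipE (txY i) (txY j).
Qed.

Lemma normal_equation :
  dt (dt nu) x
  = - (\sum_i \sum_j (inv_metric Y i j x * dx i (mean_curv Y nu) x) *: dx j Y x)
    + \sum_i \sum_j (inv_metric Y i j x * inner_prod (nu x) (dt (dx i Y) x)) *:
        (\sum_k \sum_l
           (2 * inv_metric Y k l x * inner_prod (dx j Y x) (dt (dx l Y) x))
             *: dx k Y x
         + \sum_k \sum_l
           (inv_metric Y k l x * inner_prod (dx l Y x) (dt (dx j Y) x))
             *: dx k Y x
         - dt (dx j Y) x).
Proof.
rewrite (vec_represents_dt (vec_represents_dt nuv) Ux).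
rewrite (normal_evolution sdx_leibniz two_reg v_unit v_perp giK sdt_leibniz
  sdt_comm smfun_flow).
rewrite map_mxD map_mxN; congr (- _ + _); rewrite map_mx_sum.
  apply: eq_bigr => i _; rewrite map_mx_sum; apply: eq_bigr => j _.
  by rewrite map_mxZ rmorphM /= (xY j) giE (represents_dx i represents_H Ux).
apply: eq_bigr => i _; rewrite map_mx_sum; apply: eq_bigr => j _.
rewrite map_mxZ rmorphM /=; congr ((_ * _) *: _); first exact/esym/giE.
  exact: ipE (nuv Ux) (txY i).
rewrite map_mxB map_mxD; congr (_ + _ - _); last exact/esym/txY.
  rewrite map_mx_sum; apply: eq_bigr => k _; rewrite map_mx_sum; apply: eq_bigr => l _.
  rewrite map_mxZ !rmorphM rmorph_nat /=.
  congr ((2 * _ * _) *: _); [exact/esym/giE| |exact/esym/xY].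
  exact: ipE (xY j) (txY l).
rewrite map_mx_sum; apply: eq_bigr => k _; rewrite map_mx_sum; apply: eq_bigr => l _.
rewrite map_mxZ rmorphM /=; congr ((_ * _) *: _); [exact/esym/giE| |exact/esym/xY].
exact: ipE (xY l) (txY j).
Qed.

Lemma second_form_equation i j :
  dt (dt (second_form Y nu i j)) x
  = rough_laplacian Y (second_form Y nu) i j x
    - 2 * mean_curv Y nu x * (\sum_l \sum_m
        second_form Y nu i l x * second_form Y nu m j x * inv_metric Y l m x)
    + normA2 Y nu x * second_form Y nu i j x
    + \sum_k \sum_l inv_metric Y k l x * second_form Y nu i j x
        * inner_prod (nu x) (dt (dx k Y) x) * inner_prod (nu x) (dt (dx l Y) x)
    - 2 * \sum_k dt (christoffel Y k i j) x
        * inner_prod (nu x) (dt (dx k Y) x).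
Proof.
rewrite (represents_dt (represents_dt (represents_h i j)) Ux).
rewrite (second_form_evolution sdx_leibniz sdx_comm two_reg v_unit v_perp giK
  sdt_leibniz sdt_comm smfun_flow).
rewrite rmorphB !rmorphD rmorphN; congr (_ - _ + _ + _ - _).
- rewrite rmorph_sum; apply: eq_bigr => k _.
  rewrite rmorph_sum; apply: eq_bigr => l _.
  by rewrite rmorphM /= giE (represents_nabla2_h k l i j Ux).
- rewrite !rmorphM rmorph_nat /= hgh_entry; congr (2 * _ * _); first exact/esym/HE.
  rewrite rmorph_sum; apply: eq_bigr => l _; rewrite rmorph_sum; apply: eq_bigr => m _.
  by rewrite !rmorphM /= !hE giE.
- rewrite rmorphM /= (trace_hgh sdx_comm v giK); congr (_ * _); last exact/esym/hE.
  rewrite rmorph_sum; apply: eq_bigr => a _.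
  rewrite rmorph_sum; apply: eq_bigr => b _.
  rewrite rmorph_sum; apply: eq_bigr => k _.
  rewrite rmorph_sum; apply: eq_bigr => l _.
  by rewrite !rmorphM /= !giE !hE.
- rewrite rmorph_sum; apply: eq_bigr => k _.
  rewrite rmorph_sum; apply: eq_bigr => l _.
  rewrite !rmorphM /=; congr (_ * _ * _ * _); [exact/esym/giE|exact/esym/hE| |].
    exact: ipE (nuv Ux) (txY k).
  exact: ipE (nuv Ux) (txY l).
- rewrite rmorphM rmorph_nat rmorph_sum; congr (_ * _); apply: eq_bigr => k _.
  rewrite rmorphM /=; congr (_ * _); last exact: ipE (nuv Ux) (txY k).
  exact/esym/(represents_dt (represents_christoffel k i j)).
Qed.

End Transfer.

Lemma chart_times_open (R : realType) (n : nat) (M : smoothManifold R n)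
  (c : chart R M n) (I : set R) : open I -> open (chart_times c I).
Proof.
move=> oI; rewrite openE => -[x t] [/= cx It].
exists (chart_cod c, I); last by move=> [y s] [].
by split; apply: open_nbhs_nbhs; split=> //; exact: chart_cod_open.
Qed.

Theorem theorem5p1 (R : realType) (n : nat) (M : smoothManifold R n)
    (I : set R) (I_open : open I)
    (X N : M -> R -> 'rV[R]_n.+1)
    (X_smooth : smooth_family I X)
    (X_imm : immersions I X)
    (N_normal : unit_normal I X N)
    (X_flow : hyperbolic_mcf I X N)
    (c : chart R M n) (c_atlas : atlas c)
    (N_smooth : smooth_on (chart_times c I) (in_chart c N)) :
  let Y := in_chart c X in
  let nu := in_chart c N in
  let ip := @inner_prod R n.+1 in
  let gi := inv_metric Y in
  let h := second_form Y nu in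
  let H := mean_curv Y nu in
  forall p, chart_times c I p ->
  [/\ forall i j,
        dt (dt (metric Y i j)) p
        = - (2 * H p * h i j p) + 2 * ip (dt (dx i Y) p) (dt (dx j Y) p),
      dt (dt nu) p
        = - (\sum_i \sum_j (gi i j p * dx i H p) *: dx j Y p)
          + \sum_i \sum_j (gi i j p * ip (nu p) (dt (dx i Y) p)) *:
              (\sum_k \sum_l
                 (2 * gi k l p * ip (dx j Y p) (dt (dx l Y) p)) *: dx k Y p
               + \sum_k \sum_l
                 (gi k l p * ip (dx l Y p) (dt (dx j Y) p)) *: dx k Y p
               - dt (dx j Y) p)
    & forall i j,
        dt (dt (h i j)) p
        = rough_laplacian Y h i j p
          - 2 * H p * (\sum_l \sum_m h i l p * h m j p * gi l m p)
          + normA2 Y nu p * h i j p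
          + \sum_k \sum_l gi k l p * h i j p
              * ip (nu p) (dt (dx k Y) p) * ip (nu p) (dt (dx l Y) p)
          - 2 * \sum_k dt (christoffel Y k i j) p
              * ip (nu p) (dt (dx k Y) p)].
Proof.
move=> Y nu ip gi h H p Dp.
pose U := Region (chart_times_open (c := c) I_open) (ex_intro _ p Dp).
have Y_imm : forall x, U x -> row_free (\matrix_(i < n) dx i Y x) := X_imm _ c_atlas.
have nu_normal : forall x, U x -> inner_prod (nu x) (nu x) = 1 /\
    forall i, inner_prod (nu x) (dx i Y x) = 0 := N_normal _ c_atlas.
have [y Yy] := @vec_represents_exists _ _ U _ Y (X_smooth _ c_atlas).
have [v nuv] := @vec_represents_exists _ _ U _ nu N_smooth.
have [g gK] := smfun_gram_inv Y_imm Yy.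
split=> [i j||i j].
- exact: (metric_equation Y_imm nu_normal (X_flow _ c_atlas) Yy nuv gK Dp).
- exact: (normal_equation Y_imm nu_normal (X_flow _ c_atlas) Yy nuv gK Dp).
- exact: (second_form_equation Y_imm nu_normal (X_flow _ c_atlas) Yy nuv gK Dp).
Qed.
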